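(* Let $F,\ell_1,\dots,\ell_m:\mathbb{R}^n\to\mathbb{R}$ be continuously differentiable with $\inf_{\theta}F(\theta)>-\infty$, $\inf_\theta\ell_i(\theta)>-\infty$ for all $i$, and $\sup_\theta\|\nabla F(\theta)\|\le c$. Let $e>0$, let $\alpha_t\ge0$ for all $t\in\mathbb{R}_+$, and let $\{\theta_t:t\in\mathbb{R}_+\}$ be a solution of the Pareto navigation flow $d\theta_t=-v_t\,dt$ (see context). (i) If $\theta_t\notin\mathcal{P}_e$ is a fixed point, that is, $\frac{d\theta_t}{dt}=-v_t=0$, and $F,\ell_1,\dots,\ell_m$ are convex in a neighborhood of $\theta_t$, then $\theta_t$ is a local minimum of $F$ in the Pareto closure $\overline{\{\theta_t\}}$; that is, there exists a neighborhood of $\theta_t$ containing no point $\theta'$ such that $F(\theta')<F(\theta_t)$ and $\vec\ell(\theta')\preceq\vec\ell(\theta_t)$. (ii) If $\theta_t\in\mathcal{P}_e$, then $v_t=\nabla F(\theta_t)$, and hence a fixed point with $\frac{d\theta_t}{dt}=-v_t=0$ is an unconstrained local minimum of $F$ whenever $F$ is convex in a neighborhood of $\theta_t$.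
   Context: $\|\cdot\|$ is the Euclidean norm, $\mathbb{R}_+=[0,\infty)$, $\mathcal{C}^m=\{\omega\in\mathbb{R}_+^m:\sum_i\omega_i=1\}$, and $\vec\ell=(\ell_1,\dots,\ell_m)$. Define $$g(\theta)=\min_{\omega\in\mathcal{C}^m}\Big\|\sum_{i=1}^m\omega_i\nabla\ell_i(\theta)\Big\|^2,\qquad \mathcal{P}_e=\{\theta\in\mathbb{R}^n:g(\theta)\le e\}.$$ Write $\vec\ell(\theta')\preceq\vec\ell(\theta)$ if $\ell_i(\theta')\le\ell_i(\theta)$ for all $i$; the Pareto closure of a point is $\overline{\{\theta\}}=\{\theta'\in\mathbb{R}^n:\vec\ell(\theta')\preceq\vec\ell(\theta)\}$. Pareto navigation flow: $t\mapsto\alpha_t$ is measurable. The velocity $v_t$ at $\theta_t$ is $$v_t=\arg\min_{v\in\mathbb{R}^n}\tfrac12\|\nabla F(\theta_t)-v\|^2\ \text{ s.t. }\ \nabla\ell_i(\theta_t)^\top v\ge\phi_t\ \forall i,\qquad \phi_t=\begin{cases}-\infty& g(\theta_t)\le e,\\ \alpha_tg(\theta_t)& g(\theta_t)>e,\end{cases}$$ where for $\phi_t=-\infty$ the constraints are vacuous. Solutions of $d\theta_t=-v_t\,dt$ are taken in the Filippov (differential inclusion) sense: $t\mapsto\theta_t$ is locally absolutely continuous on $\mathbb{R}_+$ and for almost every $t$, $\frac{d\theta_t}{dt}=-v_t$ if $\theta_t\notin\mathcal{P}_e$; $\frac{d\theta_t}{dt}=-\nabla F(\theta_t)$ if $\theta_t$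 is in the interior of $\mathcal{P}_e$; and if $\theta_t$ is on the boundary of $\mathcal{P}_e$, $\frac{d\theta_t}{dt}=-(\beta w_t+(1-\beta)\nabla F(\theta_t))$ for some $\beta\in[0,1]$ (possibly depending on $t$), where $w_t$ is the minimizer of the same quadratic program with $\phi_t$ replaced by $\alpha_tg(\theta_t)$. *)

(* Defs.v *)
From mathcomp Require Export all_boot all_order all_algebra.
From mathcomp Require Export all_classical all_reals all_analysis.

Set Implicit Arguments.
Unset Strict Implicit.
Unset Printing Implicit Defensive.

Export Order.TTheory GRing.Theory Num.Theory.
Export numFieldNormedType.Exports.

Local Open Scope classical_set_scope.
Local Open Scope ring_scope.

Section Defs.
Context {R : realType}.

(** [`|v|] on ['rV[R]_n] is the sup norm; [enorm] is the Euclidean one. They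
    induce the same topology. *)
Definition dot n (u v : 'rV[R]_n) : R := \sum_(i < n) u 0 i * v 0 i.

Definition enorm n (v : 'rV[R]_n) : R := Num.sqrt (dot v v).

Definition gradient n (f : 'rV[R]_n -> R) (x : 'rV[R]_n) : 'rV[R]_n :=
  \row_(i < n) 'D_(delta_mx 0 i) f x.

Definition C1 n (f : 'rV[R]_n -> R) : Prop :=
  (forall x, differentiable f x) /\ continuous (gradient f).

Definition simplex m : set 'rV[R]_m :=
  [set w | (forall i, 0 <= w 0 i) /\ \sum_(i < m) w 0 i = 1].

(** For [0 < m] the simplex is compact and nonempty, so that, the gradients
    being fixed, the infimum is a minimum. *)
Definition gmin n m (l : 'I_m -> 'rV[R]_n -> R) (x : 'rV[R]_n) : R :=
  inf [set enorm (\sum_(i < m) w 0 i *: gradient (l i) x) ^+ 2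
      | w in @simplex m].

Definition pareto_set n m (l : 'I_m -> 'rV[R]_n -> R) (e : R) : set 'rV[R]_n :=
  [set x | gmin l x <= e].

Definition pareto_le n m (l : 'I_m -> 'rV[R]_n -> R) (x' x : 'rV[R]_n) : Prop :=
  forall i, l i x' <= l i x.

Definition pareto_closure n m (l : 'I_m -> 'rV[R]_n -> R) (x : 'rV[R]_n) :
  set 'rV[R]_n := [set x' | pareto_le l x' x].

Definition boundary (T : topologicalType) (A : set T) : set T :=
  closure A `\` interior A.

Definition qp_feasible n m (l : 'I_m -> 'rV[R]_n -> R) (x : 'rV[R]_n)
    (phi : \bar R) : set 'rV[R]_n :=
  [set v | forall i, (phi <= (dot (gradient (l i) x) v)%:E)%E].

Definition qp_argmin n m (F : 'rV[R]_n -> R) (l : 'I_m -> 'rV[R]_n -> R)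
    (x : 'rV[R]_n) (phi : \bar R) : set 'rV[R]_n :=
  let obj v := 2^-1 * enorm (gradient F x - v) ^+ 2 in
  [set v | qp_feasible l x phi v /\
           forall u, qp_feasible l x phi u -> obj v <= obj u].

Definition phi_out n m (l : 'I_m -> 'rV[R]_n -> R) (a : R) (x : 'rV[R]_n) :
  \bar R := (a * gmin l x)%:E.

Definition phi n m (l : 'I_m -> 'rV[R]_n -> R) (e a : R) (x : 'rV[R]_n) :
  \bar R := if gmin l x <= e then -oo%E else phi_out l a x.

(** The (one-element) set of velocities at [x], [a] being the current value of
    the control. *)
Definition velocity n m (F : 'rV[R]_n -> R) (l : 'I_m -> 'rV[R]_n -> R)
    (e a : R) (x : 'rV[R]_n) : set 'rV[R]_n :=
  qp_argmin F l x (phi l e a x).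

(** Derivative at [t >= 0] of a curve parametrized by the half-line: two-sided
    for [t > 0], right derivative at [0]. The values of [x] at negative times
    play no role. *)
Definition has_time_derivative n (x : R -> 'rV[R]_n) (t : R) (w : 'rV[R]_n) :
  Prop :=
  (fun s => (s - t)^-1 *: (x s - x t)) @ within `[0, +oo[%classic t^' --> w.

Definition abs_continuous n (a b : R) (x : R -> 'rV[R]_n) : Prop :=
  forall eps : R, 0 < eps -> exists2 delta : R, 0 < delta &
    forall (k : nat) (p q : 'I_k -> R),
      (forall i, a <= p i /\ p i <= q i /\ q i <= b) ->
      trivIset setT (fun i => `]p i, q i[%classic) ->
      \sum_(i < k) (q i - p i) < delta ->
      \sum_(i < k) enorm (x (q i) - x (p i)) < eps.

Definition loc_abs_continuous n (x : R -> 'rV[R]_n) : Prop :=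
  forall a b : R, 0 <= a -> a <= b -> abs_continuous a b x.

Definition filippov_at n m (F : 'rV[R]_n -> R) (l : 'I_m -> 'rV[R]_n -> R)
    (e : R) (alpha : R -> R) (theta : R -> 'rV[R]_n) (t : R) : Prop :=
  let x := theta t in
  [/\ ~ pareto_set l e x ->
        exists2 v, velocity F l e (alpha t) x v &
                   has_time_derivative theta t (- v),
      interior (pareto_set l e) x ->
        has_time_derivative theta t (- gradient F x) &
      boundary (pareto_set l e) x ->
        exists (beta : R) (w : 'rV[R]_n),
          [/\ 0 <= beta <= 1,
              qp_argmin F l x (phi_out l (alpha t) x) w &
              has_time_derivative theta t
                (- (beta *: w + (1 - beta) *: gradient F x))] ].

Definition pareto_flow n m (F : 'rV[R]_n -> R) (l : 'I_m -> 'rV[R]_n -> R)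
    (e : R) (alpha : R -> R) (theta : R -> 'rV[R]_n) : Prop :=
  loc_abs_continuous theta /\
  {ae @lebesgue_measure R, forall t : R,
     0 <= t -> filippov_at F l e alpha theta t}.

Definition fixed_point n m (F : 'rV[R]_n -> R) (l : 'I_m -> 'rV[R]_n -> R)
    (e : R) (alpha : R -> R) (theta : R -> 'rV[R]_n) (t : R) : Prop :=
  exists v, [/\ velocity F l e (alpha t) (theta t) v,
                has_time_derivative theta t (- v) & - v = 0].

Definition local_min_in n (F : 'rV[R]_n -> R) (A : set 'rV[R]_n)
    (x : 'rV[R]_n) : Prop :=
  exists2 U, nbhs x U & ~ exists x', [/\ U x', A x' & F x' < F x].

End Defs.

(* Main.v *)
(** At a fixed point [0] is feasible, which forces [phi_t <= 0], so every [u]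
    with [dot (grad l_i(theta_t)) u >= 0] for all [i] is feasible too, together
    with its nonnegative multiples. As [0] is then the projection of
    [grad F(theta_t)], such [u] satisfy [dot (grad F(theta_t)) u <= 0]. By the
    first-order convexity inequality, a nearby point [x'] with
    [l_i x' <= l_i theta_t] and [F x' < F theta_t] would make
    [u = theta_t - x'] a violation. *)
Require Import Defs.
From mathcomp Require Import ring lra.

Set Implicit Arguments.
Unset Strict Implicit.
Unset Printing Implicit Defensive.

Local Open Scope classical_set_scope.
Local Open Scope ring_scope.

Lemma dotZr (R : realType) n (u v : 'rV[R]_n) a : dot u (a *: v) = a * dot u v.
Proof. by rewrite /dot mulr_sumr; apply: eq_bigr => i _; rewrite mxE mulrCA. Qed.

Lemma dotNr (R : realType) n (u v : 'rV[R]_n) : dot u (- v) = - dot u v.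
Proof. by rewrite -scaleN1r dotZr mulN1r. Qed.

Lemma dot0l (R : realType) n (u : 'rV[R]_n) : dot 0 u = 0.
Proof. by rewrite /dot big1// => i _; rewrite mxE mul0r. Qed.

Lemma dot0r (R : realType) n (u : 'rV[R]_n) : dot u 0 = 0.
Proof. by rewrite -(scale0r 0) dotZr mul0r. Qed.

Lemma dot_ge0 (R : realType) n (u : 'rV[R]_n) : 0 <= dot u u.
Proof. by apply: sumr_ge0 => i _; rewrite -expr2 sqr_ge0. Qed.

Lemma dot_eq0 (R : realType) n (u : 'rV[R]_n) : dot u u = 0 -> u = 0.
Proof.
move=> /eqP; rewrite psumr_eq0; last by move=> i _; rewrite -expr2 sqr_ge0.
move=> /allP u0; apply/rowP => i; apply/eqP; rewrite mxE -sqrf_eq0 expr2.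
by apply: u0; rewrite mem_index_enum.
Qed.

Lemma sqr_enorm (R : realType) n (u : 'rV[R]_n) : enorm u ^+ 2 = dot u u.
Proof. by rewrite sqr_sqrtr// dot_ge0. Qed.

Lemma sqr_enormBZ (R : realType) n (u v : 'rV[R]_n) a :
  enorm (u - a *: v) ^+ 2 = enorm u ^+ 2 - 2 * a * dot u v + a ^+ 2 * dot v v.
Proof.
rewrite !sqr_enorm /dot !mulr_sumr -sumrB -big_split /=.
by apply: eq_bigr => i _; rewrite !mxE; ring.
Qed.

(** The differential is linear, so expanding [v] in the standard basis reduces it to the partial
    derivatives. *)
Lemma derive_dot (R : realType) n (f : 'rV[R]_n -> R) (x v : 'rV[R]_n) :
  differentiable f x -> 'D_v f x = dot (gradient f x) v.
Proof.
move=> df; rewrite deriveE// {1}(row_sum_delta v) linear_sum /dot.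
by apply: eq_bigr => i _; rewrite linearZ mxE deriveE//= mulrC.
Qed.

(** For [0 < h <= 1], convexity bounds the difference quotient of [f] at [x] along [y - x] by
    [f y - f x]; the bound survives the limit [h -> 0+], which is the directional derivative. *)
Lemma convex_gradient_le (R : realType) n (f : 'rV[R]_n -> R)
    (U : set 'rV[R]_n) (x y : 'rV[R]_n) :
  differentiable f x -> convex_function U f -> U x -> U y ->
  dot (gradient f x) (y - x) <= f y - f x.
Proof.
move=> df cf Ux Uy; rewrite -derive_dot//.
have /cvg_dnbhs_at_right fD := @diff_derivable _ _ _ f x (y - x) df.
apply: (cvgr_to_le fD).
near=> h.
have h0 : 0 < h by [].
have h1 : h <= 1 by near: h; exact: nbhs_right_le.
(* The point [x + h (y - x)] is the convex combination with weight [h] on [y] and [1 - h] on [x]. *)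
have := cf (Itv01 (ltW h0) h1) y x (mem_set Uy) (mem_set Ux).
rewrite convRE /= => fh.
have -> : h *: (y - x) + x = h *: y + unstable.onem h *: x.
  by rewrite scalerBr /unstable.onem scalerBl scale1r addrAC addrA.
rewrite -[_ *: _]/(h^-1 * _) ler_pdivrMl//.
move: fh; rewrite /unstable.onem.
set z := f _ => fh.
by rewrite lerBlDr; apply: (le_trans fh); lra.
Unshelve. all: by end_near. Qed.

(** Compare [0] with the feasible points [s *: u], [s >= 0]: optimality of [0] reads
    [2 s a <= s^2 b], and for small [s > 0] the linear term would win if [a] were positive. *)
Lemma qp_argmin0_dot_le0 (R : realType) n m (F : 'rV[R]_n -> R)
    (l : 'I_m -> 'rV[R]_n -> R) (x u : 'rV[R]_n) (p : \bar R) :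
  qp_argmin F l x p 0 -> (forall i, 0 <= dot (gradient (l i) x) u) ->
  dot (gradient F x) u <= 0.
Proof.
move=> [feas0 min0] u_ge0; set a := dot _ u; set b := dot u u.
have b0 : 0 <= b by exact: dot_ge0.
have quad s : 0 <= s -> 2 * s * a <= s ^+ 2 * b.
  move=> s0; have /min0 : qp_feasible l x p (s *: u).
    (* Feasibility of [0] says [p <= 0], while [s *: u] has nonnegative products with the
       gradients. *)
    move=> i; apply: (le_trans (feas0 i)); rewrite dot0r lee_fin dotZr.
    exact: mulr_ge0.
  by rewrite subr0 sqr_enormBZ -/a -/b; lra.
rewrite leNgt; apply/negP => a0.
(* The step [s = a / (b + 1)] is defined even when [b = 0]; substituting [a = s (b + 1)] gives
   [2 s^2 (b + 1) <= s^2 b], impossible for [s > 0]. *)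
have b1 : 0 < b + 1 by lra.
have := quad (a / (b + 1)) (divr_ge0 (ltW a0) (ltW b1)).
set s := a / (b + 1).
have s0 : 0 < s by exact: divr_gt0.
have -> : a = s * (b + 1) by rewrite divfK// gt_eqF.
by nra.
Qed.

(** The gradient is itself feasible with objective [0], so any minimizer is at distance zero from
    it. *)
Lemma qp_argmin_unconstrained (R : realType) n m (F : 'rV[R]_n -> R)
    (l : 'I_m -> 'rV[R]_n -> R) (x : 'rV[R]_n) :
  qp_argmin F l x -oo%E = [set gradient F x].
Proof.
have feas v : qp_feasible l x -oo%E v by move=> i; exact: leNye.
apply/seteqP; split => [v [_ /(_ _ (feas (gradient F x)))]|_ ->] /=.
  rewrite subrr !sqr_enorm dot0l mulr0 pmulr_rle0 ?invr_gt0// => v_le0.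
  apply/esym/eqP; rewrite -subr_eq0; apply/eqP/dot_eq0/le_anti.
  by rewrite v_le0 dot_ge0.
split=> // u _; rewrite subrr !sqr_enorm dot0l mulr0.
by rewrite mulr_ge0 ?invr_ge0 ?dot_ge0.
Qed.

Theorem theorem3 (R : realType) (n m : nat) (hm : (0 < m)%N)
  (F : 'rV[R]_n -> R) (l : 'I_m -> 'rV[R]_n -> R) (c e : R)
  (alpha : R -> R) (theta : R -> 'rV[R]_n)
  (F_C1 : C1 F) (l_C1 : forall i, C1 (l i))
  (F_lb : has_lbound (range F)) (l_lb : forall i, has_lbound (range (l i)))
  (gradF_le : forall x, enorm (gradient F x) <= c)
  (e_gt0 : 0 < e)
  (alpha_meas : measurable_fun (`[0, +oo[%classic : set R) alpha)
  (alpha_ge0 : forall t, 0 <= t -> 0 <= alpha t)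
  (flow : pareto_flow F l e alpha theta) :
  (forall t, 0 <= t -> ~ pareto_set l e (theta t) ->
     fixed_point F l e alpha theta t ->
     (exists U : set 'rV[R]_n,
        [/\ nbhs (theta t) U, convex_set U, convex_function U F &
            forall i, convex_function U (l i)]) ->
     local_min_in F (pareto_closure l (theta t)) (theta t)) /\
  (forall t, 0 <= t -> pareto_set l e (theta t) ->
     velocity F l e (alpha t) (theta t) = [set gradient F (theta t)] /\
     (fixed_point F l e alpha theta t ->
      (exists U : set 'rV[R]_n,
         [/\ nbhs (theta t) U, convex_set U & convex_function U F]) ->
      local_min_in F setT (theta t))).
Proof.
split=> t t0 Pt.
- move=> [v [vel _ /eqP]]; rewrite oppr_eq0 => /eqP v0 [U [Ux _ cF cl]].
  subst v.
  exists U => // -[y [Uy ly Fy]].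
  have Uxx := nbhs_singleton Ux.
  (* The direction is [theta t - y]: each [l i] does not increase from [theta t] to [y], so the
     first-order inequality makes its product with the gradient of [l i] nonnegative. *)
  have : dot (gradient F (theta t)) (- (y - theta t)) <= 0.
    apply: (qp_argmin0_dot_le0 vel) => i; rewrite dotNr oppr_ge0.
    apply: le_trans (convex_gradient_le ((l_C1 i).1 _) (cl i) Uxx Uy) _.
    by rewrite subr_le0; exact: ly.
  rewrite dotNr oppr_le0 => /le_trans /(_ (convex_gradient_le (F_C1.1 _) cF Uxx Uy)).
  by rewrite subr_ge0 leNgt Fy.
- have velE : velocity F l e (alpha t) (theta t) = [set gradient F (theta t)].
    by rewrite /velocity /phi (Pt : gmin _ _ <= e) qp_argmin_unconstrained.
  split=> // -[v [+ _ /eqP]]; rewrite velE oppr_eq0 => /= -> /eqP gF0 [U [Ux _ cF]].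
  (* With a vanishing gradient, the first-order inequality becomes [0 <= F y - F (theta t)] on all
     of [U]. *)
  exists U => // -[y [Uy _]]; apply/negP; rewrite -leNgt -subr_ge0.
  have := convex_gradient_le (F_C1.1 _) cF (nbhs_singleton Ux) Uy.
  by rewrite gF0 dot0l.
Qed.
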